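(* Let $1<p\le2$ and fix $0\le\ell<u$ and $n\ge2$. Then $\operatorname{vol}(\breve{U}^*_p(\boldsymbol\xi))$, where $\boldsymbol\xi=(\ell,\xi_1,\ldots,\xi_{n-1},u)$, has a unique minimizer satisfying $\ell<\xi_1<\cdots<\xi_{n-1}<u$.
   Context: Let $f(x):=x^p$ on $[\ell,u]$. Write $\xi_0:=\ell$, $\xi_n:=u$, put $\tau_0:=\ell$, $\tau_{n+1}:=u$ and, for $i=1,\ldots,n$, $$\tau_i:=\frac{[f(\xi_i)-f'(\xi_i)\xi_i]-[f(\xi_{i-1})-f'(\xi_{i-1})\xi_{i-1}]}{f'(\xi_{i-1})-f'(\xi_i)},$$ the abscissa of the intersection of the tangent lines to $f$ at $\xi_{i-1}$ and $\xi_i$. Let $g:[\ell,u]\to\mathbb{R}$ be the piecewise-linear function whose graph connects, in order, $(\ell,f(\ell))$, the points $(\tau_i,\ f(\xi_i)+f'(\xi_i)(\tau_i-\xi_i))$ for $i=1,\ldots,n$, and $(u,f(u))$. With $s:=\frac{f(u)-f(\ell)}{u-\ell}$, the set $\breve{U}^*_p(\boldsymbol\xi)$ is the closure of the convex hull of $$\left\{(x,y,z)\in\mathbb{R}^3:\ (f(\ell)-s\ell)z+sx\ge y\ge z\,g(x/z),\ uz\ge x\ge \ell z,\ 1\ge z>0,\ y\ge 0\right\}.$$ $\operatorname{vol}$ denotes 3-dimensional volume. *)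

(* Defs.v *)
From HB Require Import structures.
From mathcomp Require Import all_boot all_order all_algebra.
From mathcomp Require Import all_classical all_reals all_analysis.
Set Implicit Arguments.
Unset Strict Implicit.
Unset Printing Implicit Defensive.
Import Order.TTheory GRing.Theory Num.Theory numFieldNormedType.Exports.
Local Open Scope classical_set_scope.
Local Open Scope ring_scope.

Section ConvexHull.
Variables (R : realType) (M : lmodType R).

Definition convex_hull (A : set M) : set M := smallest (@convex_set R M) A.

End ConvexHull.

Definition vol3 (R : realType) (A : set (R * R * R)) : \bar R :=
  ((lebesgue_measure \x lebesgue_measure) \x lebesgue_measure)%E A.

(* The function whose graph is the polygonal line through the points
   (t i, v i), i = 0, ..., m, for an increasing sequence of abscissas t;
   it is only meaningful on [t 0, t m]. *)
Fixpoint pl_interp (R : realType) (t v : nat -> R) (m : nat) (x : R) : R :=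
  if m is k.+1 then
    if x <= t k then pl_interp t v k x
    else v k + (v k.+1 - v k) / (t k.+1 - t k) * (x - t k)
  else v 0%N.

Section TangentUnderestimator.
Variables (R : realType) (f f' : R -> R) (l u : R) (n : nat) (xi : nat -> R).

Definition tangent (i : nat) (x : R) : R :=
  f (xi i) + f' (xi i) * (x - xi i).

Definition tau (i : nat) : R :=
  if i == 0%N then l
  else if i == n.+1 then u
  else ((f (xi i) - f' (xi i) * xi i)
          - (f (xi i.-1) - f' (xi i.-1) * xi i.-1))
         / (f' (xi i.-1) - f' (xi i)).

Definition tau_val (i : nat) : R :=
  if i == 0%N then f l
  else if i == n.+1 then f u
  else tangent i (tau i).

Definition pl_under : R -> R := pl_interp tau tau_val n.+1.

End TangentUnderestimator.

Section PerspectiveRelaxation.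
Variables (R : realType) (f : R -> R) (l u : R) (g : R -> R).

Definition secant_slope : R := (f u - f l) / (u - l).

Definition perspective_set : set (R * R * R) :=
  [set w | let: (x, y, z) := w in
     [/\ (f l - secant_slope * l) * z + secant_slope * x >= y,
         y >= z * g (x / z),
         l * z <= x <= u * z,
         0 < z <= 1
       & y >= 0]].

Definition perspective_relaxation : set (R * R * R) :=
  closure (convex_hull perspective_set).

End PerspectiveRelaxation.

(* xi lists the interior points xi_1, ..., xi_(n-1); the knots are
   xi_0 = l, xi_1, ..., xi_(n-1), xi_n = u. *)
Definition knots (R : realType) (l u : R) (n : nat) (xi : n.-1.-tuple R) :
    seq R :=
  l :: rcons xi u.

(* At x = 0 the derivative p * x `^ (p - 1) vanishes when 1 < p: it is the
   right derivative there, powR being meaningful only on nonnegative bases. *)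
Definition U_star (R : realType) (p l u : R) (n : nat) (xi : n.-1.-tuple R) :
    set (R * R * R) :=
  let f x := x `^ p in
  let f' x := p * x `^ (p - 1) in
  perspective_relaxation f l u
    (pl_under f f' l u n (nth 0 (knots l u xi))).

(* Main.v *)
Require Import Defs.
From HB Require Import structures.
From mathcomp Require Import all_boot all_order all_algebra.
From mathcomp Require Import all_classical all_reals all_analysis.
From mathcomp Require Import lra ring.
Set Implicit Arguments.
Unset Strict Implicit.
Unset Printing Implicit Defensive.
Import Order.TTheory GRing.Theory Num.Theory numFieldNormedType.Exports.
Local Open Scope classical_set_scope.
Local Open Scope ring_scope.

(** Why there is exactly one minimizer.

    Write [f x = x^p] and let [T_a] be the tangent of [f] at [a].  The
    relaxation is cut out by finitely many linear inequalities, and its slice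
    at height [z] is the image by the homothety of ratio [z] of the plane
    region between the secant and the polygonal line [g]; so its volume is a
    third of the area of that region ([vol3_perspective_relaxation]).  On
    [[l, u]] the line [g] is the maximum of the tangents at the knots
    ([pl_under_envelope]).  Minimizing the volume thus amounts to maximizing
    the integral of the maximum of the tangents at [l], [u] and [n - 1] points
    of [[l, u]], an objective that depends only on the set of these points.

    Existence.  The objective is continuous on the compact cube [[l, u]^(n-1)],
    so it has a maximizer there ([envelope_integral_max]).  Its entries are
    distinct and interior: a repeated or extreme entry could be traded for a
    new tangency point, where the envelope, strictly below [f] before, would
    be raised to [f] ([envelope_integral_insert]).  Sorting the entries gives
    an admissible maximizer.

    Criticality.  Let [tau_i] be the abscissa where the tangents at [xi_(i-1)]
    and [xi_i] cross.  For a maximizer, [xi_i] is the midpoint [z] of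
    [tau_i] and [tau_(i+1)]: otherwise replacing [xi_i] by [z] gains at least
    the integral of [T_z - T_(xi_i)] over [[tau_i, tau_(i+1)]], which is the
    length of that segment times the value [f z - T_(xi_i) z > 0] of the
    integrand at its midpoint ([envelope_integral_recentre]).

    Uniqueness.  The crossing abscissa of the tangents at [a] and [b] is
    increasing in [a] and in [b], and for a power function it is homogeneous
    of degree one.  Given two critical sequences [k] and [k'] with the same
    ends, let [c] be the largest ratio [k'_i / k_i].  If [c > 1], then [k'] lies
    below [c k] and touches it at an inner index; since the midpoint equations
    are preserved by scaling and are monotone in the neighbours, the contact
    propagates to the last index, where [u = c u] is absurd ([critical_le]). *)

(** * Tangent lines and their crossings *)

Section TangentLines.
Variables (R : realType) (f f' : R -> R).

Definition tline (a x : R) : R := f a + f' a * (x - a).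

Definition crossing (a b : R) : R :=
  ((f b - f' b * b) - (f a - f' a * a)) / (f' a - f' b).

(** This is the only form in which strict convexity is used; it makes sense on
    a domain where [f'] is merely a family of slopes. *)
Definition above_tangents (D : {pred R}) : Prop :=
  {in D &, forall a x, a != x -> tline a x < f x}.

Lemma tline_diag a : tline a a = f a.
Proof. by rewrite /tline subrr mulr0 addr0. Qed.

(** The crossing abscissa is where the affine difference of two tangents
    changes sign; every comparison of tangents below goes through this identity. *)
Lemma tlineB a b x : f' a != f' b ->
  tline b x - tline a x = (f' b - f' a) * (x - crossing a b).
Proof.
move=> ne; have ne0 : f' a - f' b != 0 by rewrite subr_eq0.
by rewrite /tline /crossing; field.
Qed.

Section OnDomain.
Variable D : {pred R}.
Hypothesis hT : above_tangents D.

Lemma le_tline a x : a \in D -> x \in D -> tline a x <= f x.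
Proof.
move=> aD xD; have [->|ax] := eqVneq a x; first by rewrite tline_diag.
by rewrite ltW ?hT.
Qed.

Lemma slope_lt a b : a \in D -> b \in D -> a < b -> f' a < f' b.
Proof.
move=> aD bD ab.
have h1 := hT aD bD (negbT (lt_eqF ab)); have h2 := hT bD aD (negbT (gt_eqF ab)).
rewrite -subr_gt0 -(pmulr_lgt0 _ (_ : 0 < b - a)) ?subr_gt0//.
by move: h1 h2; rewrite /tline; lra.
Qed.

Lemma tlineB_lt a b x : a \in D -> b \in D -> a < b ->
  (tline a x < tline b x) = (crossing a b < x).
Proof.
move=> aD bD ab; have s := slope_lt aD bD ab.
by rewrite -subr_gt0 tlineB ?lt_eqF// pmulr_rgt0 ?subr_gt0.
Qed.

Lemma tlineB_le a b x : a \in D -> b \in D -> a < b ->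
  (tline a x <= tline b x) = (crossing a b <= x).
Proof.
move=> aD bD ab; have s := slope_lt aD bD ab.
by rewrite -subr_ge0 tlineB ?lt_eqF// pmulr_rge0 ?subr_gt0// subr_ge0.
Qed.

Lemma tline_crossing a b : a \in D -> b \in D -> a < b ->
  tline a (crossing a b) = tline b (crossing a b).
Proof.
move=> aD bD ab; apply/eqP; rewrite -subr_eq0 -opprB oppr_eq0.
by rewrite tlineB ?subrr ?mulr0// lt_eqF// slope_lt.
Qed.

(** At [a] the tangent at [a] touches [f], hence is still above the other one. *)
Lemma crossing_gt a b : a \in D -> b \in D -> a < b -> a < crossing a b.
Proof.
move=> aD bD ab; rewrite ltNge -tlineB_le// -ltNge tline_diag.
by rewrite hT// gt_eqF.
Qed.

Lemma crossing_lt a b : a \in D -> b \in D -> a < b -> crossing a b < b.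
Proof. by move=> aD bD ab; rewrite -tlineB_lt// tline_diag hT// lt_eqF. Qed.

Lemma tline_lt_right a b x : a \in D -> b \in D -> a < b -> x <= a ->
  tline b x < tline a x.
Proof.
move=> aD bD ab xa; rewrite ltNge tlineB_le// -ltNge.
exact: le_lt_trans (crossing_gt aD bD ab).
Qed.

Lemma crossing_chain a b c : a \in D -> b \in D -> c \in D -> a < b -> b < c ->
  crossing a b < crossing b c.
Proof.
move=> aD bD cD ab bc.
exact: lt_trans (crossing_lt aD bD ab) (crossing_gt bD cD bc).
Qed.

(** Moving the right tangency point from [b] to [c] lowers the right tangent to
    the left of [b], in particular at the old crossing, so that the left tangent
    stays on top for longer. *)
Lemma crossing_ltr a b c : a \in D -> b \in D -> c \in D -> a < b -> b < c ->
  crossing a b < crossing a c.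
Proof.
move=> aD bD cD ab bc; have ac := lt_trans ab bc.
rewrite ltNge -tlineB_le// -ltNge tline_crossing//.
by rewrite tline_lt_right// ltW// crossing_lt.
Qed.

(** At the crossing of the tangents at [b] and [c] the tangent at [a] has already
    been overtaken by the one at [b], hence by the one at [c]. *)
Lemma crossing_ltl a b c : a \in D -> b \in D -> c \in D -> a < b -> b < c ->
  crossing a c < crossing b c.
Proof.
move=> aD bD cD ab bc; have ac := lt_trans ab bc.
by rewrite -tlineB_lt// -(tline_crossing bD cD bc) tlineB_lt// crossing_chain.
Qed.

Lemma crossing_le a b a' b' : a \in D -> b \in D -> a' \in D -> b' \in D ->
  a < b -> a' < b' -> a <= a' -> b <= b' -> crossing a b <= crossing a' b'.
Proof.
move=> aD bD a'D b'D ab ab'; rewrite [a <= _]le_eqVlt [b <= _]le_eqVlt => aa' bb'.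
have ab2 : a < b' by case/orP: bb' => [/eqP <-//|]; exact: lt_trans.
apply: (@le_trans _ _ (crossing a b')).
  by case/orP: bb' => [/eqP ->//|bb']; rewrite ltW// crossing_ltr.
by case/orP: aa' => [/eqP ->//|aa']; rewrite ltW// crossing_ltl.
Qed.

End OnDomain.
End TangentLines.

(** * Integrals over segments *)

Section IntegralsOverSegments.
Variable R : realType.
Local Notation mu := (@lebesgue_measure R).
Implicit Types (h k : R -> R) (a b l u : R).

Lemma continuous_itv_integrable h a b :
  continuous h -> mu.-integrable `[a, b] (EFin \o h).
Proof.
move=> ch; apply: continuous_compact_integrable; first exact: segment_compact.
exact: continuous_subspaceT.
Qed.

Lemma continuous_affine (c d : R) : continuous (fun x : R => c + d * x).
Proof.
move=> x; apply: cvgD; first exact: cvg_cst.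
by apply: cvgM; [exact: cvg_cst|exact: cvg_id].
Qed.

(** The integral is the length times the value at the midpoint: this is why
    optimal tangency points are midpoints. *)
Lemma integral_affine (c d a b : R) : a < b ->
  (\int[mu]_(x in `[a, b]) (c + d * x)%:E =
    ((b - a) * (c + d * ((a + b) / 2)))%:E)%E.
Proof.
move=> ab; pose F (x : R) := c * x + d / 2 * x ^+ 2.
have dF (x : R) : is_derive x 1 F (c + d * x).
  by rewrite /F; apply: is_derive_eq; rewrite /GRing.scale/=; field.
have cF : continuous F.
  by move=> y; apply/differentiable_continuous/derivable1_diffP; case: (dF y).
rewrite (@continuous_FTC2 _ _ F)//.
- by rewrite -EFinB; congr EFin; rewrite /F; field.
- exact/continuous_subspaceT/continuous_affine.
- split.
  + by move=> x _; case: (dF x).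
  + exact/cvg_at_right_filter/cF.
  + exact/cvg_at_left_filter/cF.
- by move=> x _; rewrite derive1E (@derive_val _ _ _ _ _ _ _ (dF x)).
Qed.

(** A strict gain in integral only needs a gain of positive mean on one
    subsegment, even if [k - h] changes sign there.  The gain is bounded below by
    an affine function so that its mean can be read off at the midpoint. *)
Lemma Rintegral_lt_on_subsegment h k (c d a b l u : R) :
    continuous h -> continuous k -> l <= a -> a < b -> b <= u ->
    {in `[l, u], forall x, x \notin `[a, b] -> h x <= k x} ->
    {in `[a, b], forall x, c + d * x <= k x - h x} ->
    0 < c + d * ((a + b) / 2) ->
  \int[mu]_(x in `[l, u]) h x < \int[mu]_(x in `[l, u]) k x.
Proof.
move=> ch ck la ab bu out ins pos.
have sub : `[a, b] `<=` `[l, u].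
  by apply: subset_itv; rewrite bnd_simp.
have ih := @continuous_itv_integrable h l u ch.
have ik := @continuous_itv_integrable k l u ck.
(* A lower bound of [k - h] on the whole of [[l, u]]. *)
pose g : R -> R := (fun x => c + d * x) \_ `[a, b].
rewrite -subr_gt0 -RintegralB//.
apply: (@lt_le_trans _ _ (\int[mu]_(x in `[l, u]) g x)).
  rewrite -Rintegral_mkcondr setIidr// /Rintegral integral_affine//=.
  by rewrite mulr_gt0// subr_gt0.
apply: le_Rintegral => //.
- rewrite (_ : _ \o _ = (EFin \o (fun x => c + d * x)) \_ `[a, b]); last first.
    by apply/funext => x; rewrite /g /= /patch; case: ifP.
  apply/integrable_restrict => //.
  rewrite setIidr//; exact/continuous_itv_integrable/continuous_affine.
- apply: continuous_itv_integrable => x; exact: cvgB (ck x) (ch x).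
- move=> x xlu; rewrite /g patchE; case: ifPn => [|].
    by rewrite inE => xab; exact: ins.
  by rewrite notin_setE => xab; rewrite subr_ge0 out//; exact/negP.
Qed.

End IntegralsOverSegments.

(** * The upper envelope of the tangents *)

Section TangentEnvelope.
Variables (R : realType) (f f' : R -> R) (l u : R).
Local Notation mu := (@lebesgue_measure R).
Local Notation T := (tline f f').
Implicit Types (S : seq R) (s x y : R).

(** The end tangents are the initial value of the maximum, so that a list of
    nodes stands for its interior tangency points only. *)
Definition envelope S x : R :=
  \big[Num.max/Num.max (T l x) (T u x)]_(s <- S) T s x.

Definition envelope_integral S : R := \int[mu]_(x in `[l, u]) envelope S x.

Lemma tline_le_envelope S s x : s \in [:: l, u & S] -> T s x <= envelope S x.
Proof.
rewrite !inE /envelope => /or3P[/eqP->|/eqP->|sS].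
- by apply: le_trans (bigmax_ge_id _ _ _ _); rewrite le_max lexx.
- by apply: le_trans (bigmax_ge_id _ _ _ _); rewrite le_max lexx orbT.
- exact: (bigmax_sup_seq _ s).
Qed.

Lemma envelope_le S x y :
  {in [:: l, u & S], forall s, T s x <= y} -> envelope S x <= y.
Proof.
move=> h; rewrite /envelope big_seq; apply: bigmax_le => [|s sS].
  by rewrite ge_max !h ?inE ?eqxx ?orbT.
by apply: h; rewrite !inE sS !orbT.
Qed.

Lemma envelope_lt S x y :
  {in [:: l, u & S], forall s, T s x < y} -> envelope S x < y.
Proof.
move=> h; rewrite /envelope big_seq; apply: bigmax_lt => [|s sS].
  by rewrite gt_max !h ?inE ?eqxx ?orbT.
by apply: h; rewrite !inE sS !orbT.
Qed.

Lemma envelope_sub S S' x : {subset [:: l, u & S] <= [:: l, u & S']} ->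
  envelope S x <= envelope S' x.
Proof. by move=> sub; apply: envelope_le => s /sub; exact: tline_le_envelope. Qed.

Lemma continuous_tline s : continuous (T s).
Proof.
rewrite (_ : T s = fun x => (f s - f' s * s) + f' s * x); last first.
  by apply/funext => x; rewrite /tline; ring.
exact: continuous_affine.
Qed.

Lemma continuous_envelope S : continuous (envelope S).
Proof.
elim: S => [|s S IH] x; rewrite /envelope.
  rewrite (_ : (fun _ => _) = T l \max T u); last first.
    by apply/funext => y; rewrite big_nil.
  by apply: continuous_max; exact: continuous_tline.
rewrite (_ : (fun _ => _) = T s \max envelope S); last first.
  by apply/funext => y; rewrite big_cons.
by apply: continuous_max; [exact: continuous_tline|exact: IH].
Qed.

Lemma envelope_integral_sub S S' :
  {subset [:: l, u & S] <= [:: l, u & S']} ->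
  envelope_integral S <= envelope_integral S'.
Proof.
move=> sub; apply: le_Rintegral => //.
- exact/continuous_itv_integrable/continuous_envelope.
- exact/continuous_itv_integrable/continuous_envelope.
- by move=> x _; exact: envelope_sub.
Qed.

Variable D : {pred R}.
Hypothesis hT : above_tangents f f' D.
Hypothesis luD : {subset `[l, u] <= D}.

(** At the new tangency point [x0] the old envelope is strictly below [f] while
    the new one equals [f]; by continuity the gap persists around [x0]. *)
Lemma envelope_integral_insert S S' (x0 : R) :
    {subset [:: l, u & S] <= `[l, u]} ->
    {subset [:: l, u & S] <= [:: l, u & S']} ->
    x0 \in `]l, u[ -> x0 \notin S -> x0 \in S' ->
  envelope_integral S < envelope_integral S'.
Proof.
move=> Slu sub x0lu x0S x0S'.
have /andP[lx0 x0u] : l < x0 < u by move: x0lu; rewrite in_itv.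
pose g x := envelope S' x - envelope S x.
have cg : continuous g.
  by move=> x; apply: cvgB; exact: continuous_envelope.
have g0 : 0 < g x0.
  rewrite subr_gt0; apply: (@lt_le_trans _ _ (T x0 x0)); last first.
    by rewrite tline_le_envelope// !inE x0S' !orbT.
  rewrite tline_diag; apply: envelope_lt => s sS.
  apply: (hT (luD (Slu _ sS))); first by apply: luD; rewrite in_itv/= !ltW.
  move: sS; rewrite !inE => /or3P[/eqP->|/eqP->|sS]; first by rewrite lt_eqF.
    by rewrite gt_eqF.
  by apply: contraNneq x0S => <-.
have gh : g x0 / 2 < g x0 by rewrite ltr_pdivrMr// mulr2n mulrDr mulr1 ltrDl.
have [e /= e0 eg] : nbhs_ball x0 [set y | g x0 / 2 < g y].
  by apply/nbhs_ballP; exact: cvgr_gt (cg x0) _ gh.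
(* The subsegment must fit both in [[l, u]] and in the ball of radius [e]. *)
pose r := Num.min (e / 2) (Num.min (x0 - l) (u - x0)).
have r0 : 0 < r by rewrite /r !lt_min !subr_gt0 lx0 x0u divr_gt0.
have [re rl ru] : [/\ r <= e / 2, r <= x0 - l & r <= u - x0].
  by rewrite /r; split; rewrite !ge_min lexx ?orbT.
apply: (@Rintegral_lt_on_subsegment _ _ _ (g x0 / 2) 0 (x0 - r) (x0 + r)).
- exact: continuous_envelope.
- exact: continuous_envelope.
- by lra.
- by lra.
- by lra.
- by move=> x _ _; exact: envelope_sub.
- move=> x; rewrite in_itv/= mul0r addr0 => xr; apply/ltW/eg => /=.
  by rewrite /ball/= ltr_norml; apply/andP; split; lra.
- by rewrite mul0r addr0 divr_gt0.
Qed.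

(** A tangent is the highest one wherever it has overtaken those to its left and
    not yet been overtaken by those to its right. *)
Lemma envelope_tline S b x :
    {subset [:: l, u & S] <= `[l, u]} -> b \in [:: l, u & S] ->
    {in [:: l, u & S], forall s, s < b -> crossing f f' s b <= x} ->
    {in [:: l, u & S], forall s, b < s -> x <= crossing f f' b s} ->
  envelope S x = T b x.
Proof.
move=> Slu bS left_b right_b.
have inD s : s \in [:: l, u & S] -> s \in D by move/Slu/luD.
apply/le_anti/andP; split; last exact: tline_le_envelope.
apply: envelope_le => s sS; have [sb|bs|->//] := ltgtP s b.
  by rewrite (tlineB_le hT) ?inD// left_b.
by rewrite leNgt (tlineB_lt hT) ?inD// -leNgt right_b.
Qed.

(** Let [b] have neighbours [a] and [c] among the nodes.  On the segment where the
    tangent at [b] is the highest, the tangent at the midpoint [z] of the segment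
    has a larger mean; off that segment the tangent at [b] is dominated by those
    at [a] or [c], so that dropping it costs nothing. *)
Lemma envelope_integral_recentre S S' a b c :
    let z := (crossing f f' a b + crossing f f' b c) / 2 in
    {subset [:: l, u & S] <= `[l, u]} ->
    a \in [:: l, u & S] -> b \in S -> c \in [:: l, u & S] -> a < b -> b < c ->
    {in [:: l, u & S], forall s, [|| s <= a, s == b | c <= s]} ->
    {in [:: l, u & S], forall s, s != b -> s \in [:: l, u & S']} ->
    z \in S' -> b != z ->
  envelope_integral S < envelope_integral S'.
Proof.
move=> z Slu aS bS cS ab bc gap sub zS' bz.
have bS' : b \in [:: l, u & S] by rewrite !inE bS !orbT.
have inD s : s \in [:: l, u & S] -> s \in D by move/Slu/luD.
have [aD bD cD] : [/\ a \in D, b \in D & c \in D] by split; exact: inD.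
have t1l : l <= crossing f f' a b.
  apply: (@le_trans _ _ a); last by rewrite ltW// (crossing_gt hT).
  by have := Slu _ aS; rewrite in_itv => /andP[].
have t2u : crossing f f' b c <= u.
  apply: (@le_trans _ _ c); first by rewrite ltW// (crossing_lt hT).
  by have := Slu _ cS; rewrite in_itv => /andP[].
have t12 := crossing_chain hT aD bD cD ab bc.
have zD : z \in D.
  by apply: luD; rewrite in_itv/= /z; apply/andP; split; lra.
pose p s := f s - f' s * s.
have TE s x : T s x = p s + f' s * x by rewrite /tline /p; ring.
have sub' s x : s \in [:: l, u & S] -> s != b -> T s x <= envelope S' x.
  by move=> sS sb; exact/tline_le_envelope/sub.
apply: (@Rintegral_lt_on_subsegment _ _ _ (p z - p b) (f' z - f' b)
          (crossing f f' a b) (crossing f f' b c)) => //.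
- exact: continuous_envelope.
- exact: continuous_envelope.
- move=> x _; rewrite in_itv/= negb_and -!ltNge => xout.
  apply: envelope_le => s sS; have [->|sb] := eqVneq s b; last exact: sub'.
  case/orP: xout => [xa|xc].
    apply: le_trans (sub' a x aS _); last by rewrite lt_eqF.
    by rewrite leNgt (tlineB_lt hT)// -leNgt ltW.
  apply: le_trans (sub' c x cS _); last by rewrite gt_eqF.
  by rewrite (tlineB_le hT)// ltW.
- move=> x; rewrite in_itv/= => /andP[ax xc].
  rewrite (envelope_tline Slu bS'); first last.
  + move=> s sS bs; apply: (le_trans xc); apply: (crossing_le hT); rewrite ?inD//.
    case/or3P: (gap s sS) => // [sa|/eqP sb]; last by rewrite sb ltxx in bs.
    by have := lt_trans bs (le_lt_trans sa ab); rewrite ltxx.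
  + move=> s sS sb; apply: le_trans ax; apply: (crossing_le hT); rewrite ?inD//.
    case/or3P: (gap s sS) => // [/eqP bs|cs]; first by rewrite bs ltxx in sb.
    by have := lt_trans sb (lt_le_trans bc cs); rewrite ltxx.
  rewrite mulrBl addrACA -opprD -!TE lerB// tline_le_envelope//.
  by rewrite !inE zS' !orbT.
- rewrite mulrBl addrACA -opprD -!TE subr_gt0 -/z tline_diag.
  exact: hT.
Qed.

End TangentEnvelope.

(** * Existence of optimal tangency points *)

Section MaximalEnvelope.
Variables (R : realType) (f f' : R -> R) (l u : R).
Hypothesis lu : l < u.
Local Notation mu := (@lebesgue_measure R).
Local Notation T := (tline f f').
Local Notation envelope := (envelope f f' l u).
Local Notation envelope_integral := (envelope_integral f f' l u).

Let intercept s := f s - f' s * s.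

(** The envelope depends on the nodes only through the intercepts and the slopes
    of the tangents. *)
Lemma envelope_integral_close (I : eqType) (r : seq I) (v w : I -> R) (e : R) :
    0 <= e ->
    {in r, forall i, `|intercept (v i) - intercept (w i)| <= e} ->
    {in r, forall i, `|f' (v i) - f' (w i)| <= e} ->
  envelope_integral (map v r) <=
    envelope_integral (map w r) + e * (1 + Num.max `|l| `|u|) * (u - l).
Proof.
move=> e0 ci cs; set M := Num.max _ _.
have M0 : 0 <= M by rewrite /M le_max normr_ge0.
have cst_int : \int[mu]_(_ in `[l, u]) (e * (1 + M)) = e * (1 + M) * (u - l).
  by rewrite Rintegral_cst//= lebesgue_measure_itv/= lte_fin lu.
rewrite -cst_int -RintegralD//; last 2 first.
- exact/continuous_itv_integrable/continuous_envelope.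
- by apply: continuous_itv_integrable => x; exact: cvg_cst.
apply: le_Rintegral => //.
- exact/continuous_itv_integrable/continuous_envelope.
- apply: continuous_itv_integrable => x; apply: cvgD; last exact: cvg_cst.
  exact: continuous_envelope.
move=> x /=; rewrite in_itv/= => /andP[lx xu].
have xM : `|x| <= M.
  rewrite ler_norml /M; have := ler_norm u; have := ler_norm (- l).
  rewrite normrN; set a := `|l|; set b := `|u| => la ub.
  have aM : a <= Num.max a b by rewrite le_max lexx.
  have bM : b <= Num.max a b by rewrite le_max lexx orbT.
  by apply/andP; split; lra.
apply: envelope_le => s; rewrite !inE => /or3P[/eqP->|/eqP->|/mapP[i ir ->{s}]].
- by rewrite ler_wpDr ?mulr_ge0 ?addr_ge0// tline_le_envelope// inE eqxx.
- by rewrite ler_wpDr ?mulr_ge0 ?addr_ge0// tline_le_envelope// !inE eqxx orbT.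
rewrite -lerBlDl; apply: (@le_trans _ _ (T (v i) x - T (w i) x)).
  by rewrite lerB// tline_le_envelope// !inE map_f// !orbT.
rewrite (_ : _ - _ = (intercept (v i) - intercept (w i)) +
                     (f' (v i) - f' (w i)) * x); last first.
  by rewrite /tline /intercept; ring.
rewrite mulrDr mulr1 lerD//; first exact: le_trans (ler_norm _) (ci i ir).
rewrite (le_trans (ler_norm _))// normrM ler_pM//; exact: cs.
Qed.

(** Compactness of the cube; the order of the nodes is disregarded, which keeps
    the domain a product of segments. *)
Lemma envelope_integral_max m :
    {within `[l, u], continuous f} -> {within `[l, u], continuous f'} ->
  exists2 S : m.-tuple R, {subset S <= `[l, u]} &
    forall S' : m.-tuple R, {subset S' <= `[l, u]} ->
      envelope_integral S' <= envelope_integral S.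
Proof.
move=> cf cf'.
have ci : {within `[l, u], continuous intercept}.
  have cid : {within `[l, u], continuous (fun s : R => s)}.
    by apply: continuous_subspaceT => y; exact: cvg_id.
  move=> x; apply: cvgB; first exact: cf.
  by apply: cvgM; [exact: cf'|exact: cid].
pose nodes (v : 'rV[R]_m) := [seq v ord0 i | i <- enum 'I_m].
pose A := [set v : 'rV[R]_m | forall i, `[l, u]%classic (v ord0 i)].
have cA : compact A.
  by apply: (@rV_compact _ _ (fun=> `[l, u]%classic)) => i; exact: segment_compact.
have A0 : A !=set0.
  by exists (\row__ l) => i; rewrite mxE /= in_itv/= lexx ltW.
have cG : {within A, continuous (envelope_integral \o nodes)}.
  apply/subspace_continuousP => v Av; apply/cvgrPdist_le => e e0.
  pose K := (1 + Num.max `|l| `|u|) * (u - l).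
  have K0 : 0 < K.
    by rewrite mulr_gt0 ?subr_gt0// ltr_wpDr// le_max normr_ge0.
  pose d := e / K; have d0 : 0 < d by rewrite divr_gt0.
  have near_coord (h : R -> R) : {within `[l, u], continuous h} ->
      \forall w \near within A (nbhs v), 
        forall i, `|h (v ord0 i) - h ((w : 'rV[R]_m) ord0 i)| <= d.
    move=> /subspace_continuousP ch; apply: filter_forall => i.
    have /cvgrPdist_le/(_ _ d0) := ch _ (Av i).
    rewrite !near_withinE => hn.
    have hv := @coord_continuous R 1 m ord0 i v _ hn.
    by apply: (@filterS _ (nbhs v) _ _ _ _ hv) => w /= hw Aw; apply: hw; exact: Aw.
  near=> w.
  have hi : forall i, `|intercept (v ord0 i) - intercept (w ord0 i)| <= d.
    by near: w; exact: near_coord.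
  have hs : forall i, `|f' (v ord0 i) - f' (w ord0 i)| <= d.
    by near: w; exact: near_coord.
  have dK : d * (1 + Num.max `|l| `|u|) * (u - l) = e.
    by rewrite -mulrA -/K /d divfK// gt_eqF.
  have close (a b : 'rV[R]_m) :
      (forall i, `|intercept (a ord0 i) - intercept (b ord0 i)| <= d) ->
      (forall i, `|f' (a ord0 i) - f' (b ord0 i)| <= d) ->
      envelope_integral (nodes a) <= envelope_integral (nodes b) + e.
    move=> hi' hs'; rewrite -[X in _ + X]dK.
    by apply: (envelope_integral_close (ltW d0)) => i _; [exact: hi'|exact: hs'].
  have vw := close v w hi hs.
  have wv : envelope_integral (nodes w) <= envelope_integral (nodes v) + e.
    by apply: close => i; rewrite distrC.
  have : `|envelope_integral (nodes v) - envelope_integral (nodes w)| <= e.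
    rewrite ler_norml; apply/andP; split; last by rewrite lerBlDl.
    by rewrite lerBrDr addrC lerBlDr.
  by [].
have [c cinA cmax] := EVT_max_rV A0 cA cG.
have sz (v : 'rV[R]_m) : size (nodes v) == m by rewrite size_map size_enum_ord.
exists (Tuple (sz c)).
  move=> _ /mapP[i _ ->]; move: cinA; rewrite inE => /(_ i).
  by [].
move=> S' S'lu; pose w : 'rV[R]_m := \row_i tnth S' i.
have -> : tval S' = nodes w.
  by rewrite -[LHS]map_tnth_enum /nodes; apply: eq_map => i; rewrite mxE.
apply: cmax; rewrite inE => i; rewrite mxE; apply: S'lu; exact: mem_tnth.
Unshelve. all: by end_near. Qed.

End MaximalEnvelope.

(** * Volumes in space by horizontal slices *)

Section PlaneMeasure.
Variable R : realType.
Local Notation mu := (@lebesgue_measure R).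

(** The product measure under a name of its own, to which a sigma-finite
    structure can be attached. *)
Definition plane_measure := (mu \x mu)%E.

HB.instance Definition _ := Measure.on plane_measure.

Let sigma_finite_plane : sigma_finite [set: R * R] plane_measure.
Proof.
pose I n : set R := `[- n%:R, n%:R]%classic.
exists (fun n : nat => I n `*` I n).
  apply/seteqP; split => // -[x y] _.
  have xy0 : 0 <= `|x| + `|y| by rewrite addr_ge0.
  exists (Num.bound (`|x| + `|y|)) => //; have := archi_boundP xy0.
  move=> /ltW xyN; split; rewrite /I /= in_itv/= -ler_norml.
    by apply: le_trans xyN; rewrite lerDl.
  by apply: le_trans xyN; rewrite lerDr.
have mI n : measurable (I n) by exact: measurable_itv.
have fI n : (mu (I n) < +oo)%E.
  by rewrite /I lebesgue_measure_itv/=; case: ifP => _; rewrite ?ltry.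
move=> n; split; first exact: measurableX.
rewrite /plane_measure product_measure1E; [|exact: mI|exact: mI].
have fI' : mu (I n) \is a fin_num by rewrite ge0_fin_numE.
by apply: lte_mul_pinfty; [exact: measure_ge0|exact: fI'|exact: fI].
Qed.

HB.instance Definition _ :=
  Measure_isSigmaFinite.Build _ _ _ plane_measure sigma_finite_plane.

Lemma volume_by_slices (A : set (R * R * R)) : measurable A ->
  vol3 A = (\int[mu]_z plane_measure (ysection A z))%E.
Proof.
move=> mA.
have := @indic_fubini_tonelli _ _ _ _ R plane_measure mu A mA.
by rewrite indic_fubini_tonelli_FE// indic_fubini_tonelli_GE.
Qed.

End PlaneMeasure.

(** * The relaxation is a polytope with homothetic slices *)

Section Polyhedra.
Variable R : realType.
Implicit Types (c : R * R * R * R) (L : seq (R * R * R * R)).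

(** The coefficients [(a, b, c, d)] stand for the inequality
    [a x + b y + c z <= d]. *)
Definition halfspace c : set (R * R * R) :=
  [set w | c.1.1.1 * w.1.1 + c.1.1.2 * w.1.2 + c.1.2 * w.2 <= c.2].

Definition polyhedron L : set (R * R * R) :=
  \bigcap_(c in [set` L]) halfspace c.

Let form c (w : R * R * R) := c.1.1.1 * w.1.1 + c.1.1.2 * w.1.2 + c.1.2 * w.2.

Lemma closed_halfspace c : closed (halfspace c).
Proof.
have cform : continuous (form c).
  have c11 : continuous (fun w : R * R * R => w.1.1).
    by move=> w; apply: continuous_comp; exact: cvg_fst.
  have c12 : continuous (fun w : R * R * R => w.1.2).
    by move=> w; apply: continuous_comp; [exact: cvg_fst|exact: cvg_snd].
  move=> w; apply: cvgD; first apply: cvgD.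
  - by apply: cvgM; [exact: cvg_cst|exact: c11].
  - by apply: cvgM; [exact: cvg_cst|exact: c12].
  - by apply: cvgM; [exact: cvg_cst|exact: cvg_snd].
rewrite (_ : halfspace c = form c @^-1` [set x | x <= c.2])//.
by apply: closed_comp => [w _|]; [exact: cform|exact: closed_le].
Qed.

Lemma measurable_halfspace c : measurable (halfspace c).
Proof.
have m11 : measurable_fun setT (fun w : R * R * R => w.1.1).
  exact: measurableT_comp.
have m12 : measurable_fun setT (fun w : R * R * R => w.1.2).
  exact: measurableT_comp.
have mform : measurable_fun setT (form c).
  apply: measurable_realfun.measurable_funD.
    apply: measurable_realfun.measurable_funD.
  - exact: measurable_realfun.measurable_funM.
  - exact: measurable_realfun.measurable_funM.
  - exact: measurable_realfun.measurable_funM.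
rewrite (_ : halfspace c = setT `&` form c @^-1` `]-oo, c.2]); last first.
  by rewrite setTI; apply/funext => w; rewrite /halfspace/= in_itv.
exact: mform.
Qed.

Lemma closed_polyhedron L : closed (polyhedron L).
Proof. by apply: closed_bigI => c _; exact: closed_halfspace. Qed.

Lemma measurable_polyhedron L : measurable (polyhedron L).
Proof.
apply: fin_bigcap_measurable; first exact: finite_seq.
by move=> c _; exact: measurable_halfspace.
Qed.

Lemma convex_polyhedron L : @convex_set R (R * R * R)%type (polyhedron L).
Proof.
move=> v w t; rewrite !inE => Lv Lw c cL.
have := Lw c cL; have := Lv c cL; rewrite /halfspace/= /conv/= /GRing.scale/=.
have t0 : 0 <= t%:num by [].
have t1 : 0 <= 1 - t%:num by rewrite subr_ge0.
rewrite /unstable.onem; move: (t%:num) t0 t1 => s s0 s1 /(ler_wpM2l s0) hv.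
move=> /(ler_wpM2l s1) hw; have := lerD hv hw; rewrite -mulrDl subrKC mul1r.
by apply: le_trans; rewrite le_eqVlt; apply/orP; left; apply/eqP; ring.
Qed.

End Polyhedra.

Section PerspectiveVolume.
Variables (R : realType) (f f' : R -> R) (l u : R) (S : seq R) (g : R -> R).
Local Notation T := (tline f f').
Local Notation env := (envelope f f' l u S).
Local Notation sl := (secant_slope f l u).
Hypothesis lu : l < u.
Hypothesis g_env : {in `[l, u], g =1 env}.
Hypothesis env_ge0 : {in `[l, u], forall x, 0 <= env x}.
Hypothesis env_le_secant :
  {in `[l, u], forall x, env x <= (f l - sl * l) + sl * x}.

Let frame_constraints : seq (R * R * R * R) :=
  [:: (0, 0, -1, 0); (0, 0, 1, 1); (-1, 0, l, 0); (1, 0, - u, 0);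
      (0, -1, 0, 0); (- sl, 1, sl * l - f l, 0)].

Let tangent_constraint (s : R) : R * R * R * R :=
  (f' s, -1, f s - f' s * s, 0).

(** The perspective constraint [z * g (x / z) <= y] is linear because [g] is a
    maximum of affine functions: each tangent [T] gives
    [z * T (x / z) <= y], which is affine in [(x, z)].  The inequalities make sense at
    [z = 0] as well, where they leave the origin only. *)
Definition perspective_polyhedron : set (R * R * R) :=
  polyhedron (frame_constraints ++ map tangent_constraint [:: l, u & S]).
Local Notation Q := perspective_polyhedron.

Lemma perspective_polyhedronP x y z : Q (x, y, z) <->
  [/\ 0 <= z <= 1, l * z <= x <= u * z, 0 <= y,
      y <= (f l - sl * l) * z + sl * x &
      {in [:: l, u & S], forall s, (f s - f' s * s) * z + f' s * x <= y}].
Proof.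
split=> [h|[/andP[z0 z1] /andP[lx xu] y0 ys h] c].
  have hf c : c \in frame_constraints -> halfspace c (x, y, z).
    by move=> cF; apply: h; rewrite /mkset mem_cat cF.
  have := hf (0, 0, -1, 0); have := hf (0, 0, 1, 1).
  have := hf (-1, 0, l, 0); have := hf (1, 0, - u, 0).
  have := hf (0, -1, 0, 0); have := hf (- sl, 1, sl * l - f l, 0).
  rewrite /frame_constraints !inE !eqxx !orbT /=.
  move=> /(_ isT) + /(_ isT) + /(_ isT) + /(_ isT) + /(_ isT) + /(_ isT).
  rewrite /halfspace/= => h5 h4 h3 h2 h1 h0.
  split; try (apply/andP; split); try lra.
  move=> s sS; have : halfspace (tangent_constraint s) (x, y, z).
    by apply: h; rewrite /mkset mem_cat map_f ?orbT.
  by rewrite /halfspace/=; lra.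
rewrite /mkset mem_cat => /orP[|/mapP[s sS ->]]; last first.
  by have := h s sS; rewrite /halfspace/=; lra.
rewrite /frame_constraints !inE.
by do 5 (case/orP => [/eqP->|]; first by rewrite /halfspace/=; lra);
  move=> /eqP->; rewrite /halfspace/=; lra.
Qed.

Lemma perspective_setE x y z : 0 < z ->
  perspective_set f l u g (x, y, z) <-> Q (x, y, z).
Proof.
move=> z0; rewrite perspective_polyhedronP /perspective_set/=.
have xz_in : l * z <= x <= u * z -> x / z \in `[l, u].
  by move=> h; rewrite in_itv/= ler_pdivlMr// ler_pdivrMr.
have TE s : (f s - f' s * s) * z + f' s * x = z * T s (x / z).
  by rewrite /tline; field; rewrite gt_eqF.
split=> [[ys yg xlu /andP[_ z1] y0]|[/andP[_ z1] xlu y0 ys h]].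
  split=> //; first by rewrite (ltW z0).
  move=> s sS; rewrite TE; apply: le_trans yg; rewrite ler_pM2l//.
  by rewrite (g_env (xz_in xlu)) tline_le_envelope.
split=> //; last by rewrite z0.
rewrite (g_env (xz_in xlu)) -ler_pdivlMl//; apply: envelope_le => s sS.
by rewrite ler_pdivlMl// -TE h.
Qed.

(** The polyhedron is convex, closed and contains the generating set, hence
    contains its closed convex hull.  Conversely its points with [z > 0] are in
    the generating set, and its only other point, the origin, is the limit of
    the points [t (l, f l, 1)] of that set as [t] tends to [0]. *)
Lemma perspective_relaxationE : perspective_relaxation f l u g = Q.
Proof.
have PQ : perspective_set f l u g `<=` Q.
  move=> [[x y] z] Pw; have /andP[z0 _] : 0 < z <= 1 by case: Pw.
  exact/(perspective_setE x y z0).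
apply/seteqP; split.
  have hullQ : convex_hull (perspective_set f l u g) `<=` Q.
    by apply: smallest_sub => //; exact: convex_polyhedron.
  have cQ : closure Q = Q by apply/esym/closure_id/closed_polyhedron.
  by rewrite -cQ; exact: (@closureS (R * R * R)%type _ _ hullQ).
move=> [[x y] z] Qw.
have [/andP[z0 z1] xlu y0 ys _] := (perspective_polyhedronP x y z).1 Qw.
have PU : perspective_set f l u g `<=` perspective_relaxation f l u g.
  by move=> w Pw; apply: subset_closure; exact: sub_gen_smallest.
move: z0; rewrite le_eqVlt => /predU1P[z0|z0]; last exact/PU/perspective_setE.
have x0 : x = 0 by move: xlu; rewrite -z0 !mulr0 -eq_le => /eqP.
have {y0 ys} y0' : y = 0 by move: y0 ys; rewrite -z0 x0 !mulr0 addr0; lra.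
rewrite x0 y0' -z0.
apply: (@closed_cvg _ _ (0^'+) _ (fun t : R => (t * l, t * f l, t))).
- exact: closed_closure.
- near=> t; apply: PU.
  have t0 : 0 < t by near: t; exact: nbhs_right_gt.
  have t1 : t <= 1 by near: t; exact: nbhs_right_le.
  have lin : l \in `[l, u] by rewrite in_itv/= lexx ltW.
  rewrite /perspective_set/= (mulrC t l) mulfK ?gt_eqF// g_env//.
  split.
  + lra.
  + rewrite ler_pM2l// (le_trans (env_le_secant lin))//; lra.
  + by rewrite lexx ler_pM2r// ltW.
  + by rewrite t0.
  + have := le_trans (env_ge0 lin) (env_le_secant lin).
    by rewrite -addrA addNr addr0 => fl0; rewrite mulr_ge0// ltW.
- have c0 (k : R) : t * k @[t --> 0^'+] --> (0 : R).
    rewrite -[X in _ --> X](mul0r k); apply: cvgM; last exact: cvg_cst.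
    exact: cvg_at_right_filter cvg_id.
  have c1 : t @[t --> 0^'+] --> (0 : R) by exact: cvg_at_right_filter cvg_id.
  exact: (cvg_pair (cvg_pair (c0 l) (c0 (f l))) c1).
Unshelve. all: by end_near. Qed.

Local Notation mu := (@lebesgue_measure R).
Let gap x := (f l - sl * l) + sl * x - env x.

Let continuous_gap : continuous gap.
Proof.
move=> x; apply: cvgB; first exact: continuous_affine.
exact: continuous_envelope.
Qed.

Let gap_ge0 : {in `[l, u], forall x, 0 <= gap x}.
Proof. by move=> x xlu; rewrite subr_ge0 env_le_secant. Qed.

Lemma integral_dilation (h : R -> R) (z : R) : continuous h -> 0 < z ->
  (\int[mu]_(x in `[(l * z)%R, (u * z)%R]) (h (x / z))%:E =
    z%:E * \int[mu]_(x in `[l, u]) (h x)%:E)%E.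
Proof.
move=> ch z0; have zn0 : z != 0 by rewrite gt_eqF.
have derM : (( *%R^~ z : R -> R)^`())%classic = cst z.
  by apply/funext => t; rewrite derive1Mr// derive1_id mul1r.
have cM : continuous ( *%R^~ z : R -> R).
  by move=> t; apply: cvgM; [exact: cvg_id|exact: cvg_cst].
have cG : continuous (fun x : R => h (x / z)).
  move=> x; apply: continuous_comp; last exact: ch.
  by apply: cvgM; [exact: cvg_id|exact: cvg_cst].
(* The substitution is [x = t * z]. *)
rewrite (@integration_by_substitution_increasing R ( *%R^~ z)
  (fun x => h (x / z)) l u (ltW lu)).
- rewrite derM -integralZl//; last exact: continuous_itv_integrable.
  by apply: eq_integral => x _; rewrite fctE/= mulfK// -EFinM mulrC.
- by move=> a b _ _; rewrite ltr_pM2r.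
- by rewrite derM => t _; exact: cvg_cst.
- by rewrite derM; exact: is_cvg_cst.
- by rewrite derM; exact: is_cvg_cst.
- split; first by move=> t _; exact: derivableM.
  + exact/cvg_at_right_filter/cM.
  + exact/cvg_at_left_filter/cM.
- exact: continuous_subspaceT.
Qed.

Lemma fiber_length x z : 0 < z <= 1 -> l * z <= x <= u * z ->
  mu (xsection (ysection Q z) x) = (z * gap (x / z))%:E.
Proof.
move=> z01 xlu; have /andP[z0 z1] := z01.
have xz : x / z \in `[l, u] by rewrite in_itv/= ler_pdivlMr// ler_pdivrMr.
pose a := z * env (x / z); pose b := (f l - sl * l) * z + sl * x.
have ab : b - a = z * gap (x / z).
  by rewrite /a /b /gap; field; rewrite gt_eqF.
have -> : xsection (ysection Q z) x = `[a, b]%classic.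
  rewrite /xsection /ysection; apply/seteqP; split => y /=.
    rewrite inE/= inE => /(perspective_setE _ _ z0)[/= yb ya _ _ _].
    rewrite in_itv/=; apply/andP; split; last exact: yb.
    by rewrite /a -(g_env xz).
  rewrite in_itv/= => /andP[ya yb]; rewrite inE/= inE.
  apply/(perspective_setE _ _ z0); split => //.
    by rewrite (g_env xz).
  by apply: le_trans ya; rewrite mulr_ge0 ?env_ge0// ltW.
rewrite lebesgue_measure_itv/= lte_fin -EFinB ab; case: ltP => // ba.
congr EFin; apply/le_anti; rewrite mulr_ge0 ?gap_ge0 ?(ltW z0)//=.
by rewrite -ab subr_le0.
Qed.

(** The slice at height [z] is the slice at height [1] scaled by [z] in both
    directions, whence the factor [z ^+ 2]; at [z = 0] it is a point. *)
Lemma slice_area z : plane_measure (ysection Q z) =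
  (if (0 <= z <= 1)%R then (z ^+ 2)%:E * \int[mu]_(x in `[l, u]) (gap x)%:E
   else 0)%E.
Proof.
rewrite /plane_measure /product_measure1.
have xsec x y : xsection (ysection Q z) x y <-> Q (x, y, z).
  by rewrite /xsection /ysection /= !inE/= inE.
have [/andP[z0 z1]|zout] := boolP (0 <= z <= 1); last first.
  rewrite integral0_eq// => x _ /=.
  rewrite [X in mu X](_ : _ = set0) ?measure0//; apply/seteqP; split => // y.
  by move=> /xsec/perspective_polyhedronP[z01]; rewrite z01 in zout.
move: z0; rewrite le_eqVlt => /predU1P[z0|z0].
  rewrite -z0 expr0n mul0e integral0_eq// => x _ /=.
  apply/eqP; rewrite -measure_le0; apply: (@le_trans _ _ (mu [set 0])).
    apply: le_measure; rewrite ?inE//.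
      by apply: measurable_xsection; apply: measurable_ysection;
        exact: measurable_polyhedron.
    move=> y; rewrite z0 => /xsec/perspective_polyhedronP[_ xlu y0 ys _] /=.
    have x0 : x = 0 by move: xlu; rewrite -z0 !mulr0 -eq_le => /eqP.
    by move: y0 ys; rewrite -z0 x0 !mulr0 addr0; lra.
  by rewrite lebesgue_measure_set1.
transitivity (\int[mu]_(x in `[(l * z)%R, (u * z)%R]) (z * gap (x / z))%:E)%E.
  rewrite [RHS]integral_mkcond; apply: eq_integral => x _ /=.
  rewrite patchE; case: ifPn => [|].
    by rewrite inE/= in_itv/= => xlu; rewrite fiber_length// z0.
  rewrite notin_setE/= in_itv/= => /negP xlu.
  rewrite [X in mu X](_ : _ = set0) ?measure0//; apply/seteqP; split => // y.
  by move=> /xsec/perspective_polyhedronP[_ xlu']; rewrite xlu' in xlu.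
rewrite (@integral_dilation (fun x => z * gap x))//; last first.
  by move=> x; apply: cvgM; [exact: cvg_cst|exact: continuous_gap].
rewrite expr2 EFinM -muleA; congr (_ * _)%E.
rewrite -integralZl//; last exact: continuous_itv_integrable.
Qed.

(** The relaxation is a cone over its top face, hence the third of the area of
    that face. *)
Lemma vol3_perspective_relaxation : vol3 (perspective_relaxation f l u g) =
  ((\int[mu]_(x in `[l, u]) gap x) / 3)%:E.
Proof.
rewrite perspective_relaxationE volume_by_slices; last first.
  exact: measurable_polyhedron.
have gE : (\int[mu]_(x in `[l, u]) (gap x)%:E)%E =
    (\int[mu]_(x in `[l, u]) gap x)%:E.
  rewrite /Rintegral fineK//; apply: integrable_fin_num => //.
  exact: continuous_itv_integrable.
set A := \int[mu]_(x in _) _ in gE *.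
transitivity (\int[mu]_(z in `[0%R, 1%R]) (z ^+ 2 * A)%:E)%E.
  rewrite [RHS]integral_mkcond; apply: eq_integral => z _.
  by rewrite slice_area gE patchE mem_setE/= in_itv/= -EFinM.
pose F (z : R) := z ^+ 3 * A / 3.
have dF (z : R) : is_derive z 1 F (z ^+ 2 * A).
  by rewrite /F; apply: is_derive_eq; rewrite /GRing.scale/=; field.
have cF : continuous F.
  by move=> y; apply/differentiable_continuous/derivable1_diffP; case: (dF y).
rewrite (@continuous_FTC2 _ _ F)//.
- by rewrite -EFinB; congr EFin; rewrite /F; field.
- apply: continuous_subspaceT => z; apply: cvgM; last exact: cvg_cst.
  exact: exprn_continuous.
- split.
  + by move=> x _; case: (dF x).
  + exact/cvg_at_right_filter/cF.
  + exact/cvg_at_left_filter/cF.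
- by move=> x _; rewrite derive1E (@derive_val _ _ _ _ _ _ _ (dF x)).
Qed.

End PerspectiveVolume.

(** * The polygonal underestimator is the envelope *)

Section PolygonalLine.
Variables (R : realType) (f f' : R -> R) (l u : R) (D : {pred R}).
Hypothesis hT : above_tangents f f' D.
Hypothesis luD : {subset `[l, u] <= D}.

(** Locates [x] in a cell of the subdivision; the left end of the first cell,
    where [pl_interp] uses a separate clause, fits the same formula. *)
Lemma pl_interpP (t v : nat -> R) m x : (0 < m)%N -> t 0%N <= x <= t m ->
  exists2 k, (k < m)%N & t k <= x <= t k.+1 /\
    pl_interp t v m x = v k + (v k.+1 - v k) / (t k.+1 - t k) * (x - t k).
Proof.
elim: m => // m IH _ /andP[t0x xtm] /=.
have [xt|tx] := leP x (t m); last by exists m; rewrite ?(ltW tx).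
case: m IH xt xtm => [_ xt0 xt1|m IH xt _].
  have xE : x = t 0%N by apply/le_anti; rewrite xt0.
  by exists 0%N; rewrite // xE subrr mulr0 addr0 lexx -xE.
have [|k km [tkx E]] := IH isT; first by rewrite t0x.
by exists k; rewrite // ltnS ltnW.
Qed.

Variables (n : nat) (s : nat -> R) (S : seq R).
Hypothesis n0 : (0 < n)%N.
Hypothesis s_incr : forall i j, (i < j <= n)%N -> s i < s j.
Hypothesis s0 : s 0%N = l.
Hypothesis sn : s n = u.
Hypothesis S_mem : forall x,
  (x \in [:: l, u & S]) <-> (exists2 i, (i <= n)%N & x = s i).

(** Both end points of the [k]-th edge lie on the tangent at the [k]-th knot, and
    the edge spans the segment between consecutive crossings, where this tangent
    is the highest. *)
Lemma pl_under_envelope :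
  {in `[l, u], pl_under f f' l u n s =1 envelope f f' l u S}.
Proof.
move=> x; rewrite in_itv/= => /andP[lx xu].
have s_lu i : (i <= n)%N -> s i \in `[l, u].
  move=> i_n; rewrite in_itv/= -s0 -sn; apply/andP; split.
    by case: i i_n => // i i_n; rewrite ltW// s_incr.
  move: i_n; rewrite leq_eqVlt => /predU1P[->//|i_n].
  by rewrite ltW// s_incr// i_n/=.
have sD i : (i <= n)%N -> s i \in D by move=> i_n; apply/luD/s_lu.
have Slu : {subset [:: l, u & S] <= `[l, u]}.
  by move=> y /S_mem[i i_n ->]; exact: s_lu.
have tauE i : (0 < i <= n)%N -> tau f f' l u n s i = crossing f f' (s i.-1) (s i).
  by case: i => // i i_n; rewrite /tau /= eqSS ltn_eqF.
have tau0 : tau f f' l u n s 0 = l by [].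
have tauS : tau f f' l u n s n.+1 = u by rewrite /tau /= eqxx.
have tau_lt k : (0 < k <= n)%N -> tau f f' l u n s k < s k.
  case: k => // k kn; rewrite tauE//=.
  by apply: (crossing_lt hT); rewrite ?sD ?s_incr ?ltnSn ?(ltnW kn).
have tau_gt k : (k < n)%N -> s k < tau f f' l u n s k.+1.
  move=> kn; rewrite tauE//=.
  by apply: (crossing_gt hT); rewrite ?sD ?s_incr ?ltnSn ?(ltnW kn).
rewrite /pl_under.
have [|k kn [/andP[kx xk] ->]] :=
    @pl_interpP (tau f f' l u n s) (tau_val f f' l u n s) n.+1 x isT.
  by rewrite tau0 tauS lx.
have tau_neq : tau f f' l u n s k < tau f f' l u n s k.+1.
  have [k0|k0] := posnP k; first by rewrite k0 tau0 -s0 tau_gt.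
  have {}tau_lt := tau_lt k; rewrite k0 -ltnS kn in tau_lt.
  apply: (lt_le_trans (tau_lt isT)).
  move: kn; rewrite ltnS leq_eqVlt => /predU1P[->|kn]; last exact/ltW/tau_gt.
  by rewrite tauS sn.
have vk : tau_val f f' l u n s k = tline f f' (s k) (tau f f' l u n s k).
  rewrite /tau_val; case: eqP => [->|_]; first by rewrite tau0 s0 tline_diag.
  by rewrite ltn_eqF.
have vk1 : tau_val f f' l u n s k.+1 = tline f f' (s k) (tau f f' l u n s k.+1).
  rewrite /tau_val /= eqSS; case: eqP => [->|/eqP kn'].
    by rewrite tauS sn tline_diag.
  have {}kn' : (k < n)%N by rewrite ltn_neqAle kn' -ltnS.
  rewrite tauE//= (tline_crossing hT)//; [exact/sD/ltnW|exact: sD|].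
  by rewrite s_incr// ltnSn.
rewrite vk vk1 (envelope_tline hT luD Slu (b := s k)); first last.
- move=> _ /S_mem[j jn ->] skj; have kj : (k < j)%N.
    rewrite ltnNge; apply/negP; rewrite leq_eqVlt => /predU1P[jk|jk].
      by rewrite jk ltxx in skj.
    have sjk : s j < s k by apply: s_incr; rewrite jk -ltnS.
    by have := lt_trans skj sjk; rewrite ltxx.
  apply: (le_trans xk); rewrite tauE ?(leq_trans kj)//=.
  apply: (crossing_le hT); rewrite ?sD ?s_incr ?kj ?ltnSn ?(leq_trans kj)//.
  by move: kj; rewrite leq_eqVlt => /predU1P[->//|kj]; rewrite ltW// s_incr// kj.
- move=> _ /S_mem[j jn ->] skj; have jk : (j < k)%N.
    rewrite ltnNge; apply/negP; rewrite leq_eqVlt => /predU1P[kj|kj].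
      by rewrite kj ltxx in skj.
    have skj' : s k < s j by apply: s_incr; rewrite kj.
    by have := lt_trans skj skj'; rewrite ltxx.
  have k0 : (0 < k)%N by exact: leq_ltn_trans jk.
  apply: le_trans kx; rewrite tauE ?k0//=.
  have pk : (k.-1 < k)%N by rewrite prednK.
  apply: (crossing_le hT); rewrite ?sD ?s_incr ?jk ?pk//.
    exact: leq_trans (leq_pred _) _.
  move: jk; rewrite -{1}(prednK k0) ltnS leq_eqVlt => /predU1P[->//|jk].
  by rewrite ltW// s_incr// jk (leq_trans (leq_pred _)).
- by apply/S_mem; exists k.
have d0 : tau f f' l u n s k.+1 - tau f f' l u n s k != 0.
  by rewrite subr_eq0 gt_eqF.
by rewrite /tline; field.
Qed.

End PolygonalLine.

(** * Tangents of power functions *)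

Section PowerFunction.
Variables (R : realType) (p : R).
Hypothesis p1 : 1 < p.
Local Notation f := (fun x : R => x `^ p).
Local Notation f' := (fun x : R => p * x `^ (p - 1)).

Let p0 : 0 < p. Proof. exact: lt_trans p1. Qed.
Let pm0 : 0 < p - 1. Proof. by rewrite subr_gt0. Qed.

Lemma continuous_within_powR (q l u : R) : 0 < q -> 0 <= l -> l < u ->
  {within `[l, u], continuous (fun x : R => x `^ q)}.
Proof.
move=> q0 l0 lu.
have cpos (x : R) : 0 < x -> {for x, continuous (fun x : R => x `^ q)}.
  move=> x0; apply/differentiable_continuous/derivable1_diffP.
  by apply: derivable_powR; rewrite in_itv/= andbT.
apply/continuous_within_itvP => //; split.
- by move=> x; rewrite in_itv/= => /andP[lx _]; apply: cpos; exact: le_lt_trans lx.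
- move: l0; rewrite le_eqVlt => /predU1P[<-|l0].
    by rewrite powR0 ?gt_eqF//; exact: powR_cvg0.
  exact/cvg_at_right_filter/cpos.
- exact/cvg_at_left_filter/cpos/(le_lt_trans l0).
Qed.

Let powR_increment (x y : R) : 0 < x -> x < y ->
  exists2 c, x < c < y & y `^ p - x `^ p = p * c `^ (p - 1) * (y - x).
Proof.
move=> x0 xy.
have [|c cxy ->] := @MVT R f f' x y xy _ (continuous_within_powR p0 (ltW x0) xy).
  move=> z; rewrite in_itv/= => /andP[xz _]; apply: is_derive1_powR.
  exact: lt_trans xz.
by exists c => //; move: cxy; rewrite in_itv.
Qed.

(** By the mean value theorem the increment of [f] has a slope strictly between
    those at the end points.  The point [0], where [powR] is not differentiable,
    is treated apart. *)
Lemma powR_above_tangents : above_tangents f f' Num.nneg.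
Proof.
move=> a x; rewrite !nnegrE => a0 x0 ax; rewrite /tline.
have mono (s t : R) : 0 <= s -> s < t -> p * s `^ (p - 1) < p * t `^ (p - 1).
  move=> s0 st; rewrite ltr_pM2l//.
  by apply: gt0_ltr_powR => //; rewrite nnegrE// ltW// (le_lt_trans s0).
move: a0; rewrite le_eqVlt => /predU1P[a0|a0].
  rewrite -a0 !powR0 ?gt_eqF// mulr0 mul0r addr0 powR_gt0//.
  by rewrite lt_def x0 andbT; rewrite -a0 eq_sym in ax.
move: x0; rewrite le_eqVlt => /predU1P[x0|x0].
  rewrite -x0 powR0 ?gt_eqF// sub0r mulrN -mulrA [_ `^ _ * a]mulrC.
  by rewrite mulr_powRB1 ?ltW// subr_lt0 ltr_pMl// powR_gt0.
rewrite -ltrBrDl; move: ax; rewrite neq_lt => /orP[ax|xa].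
  have [c /andP[ac cx] ->] := powR_increment a0 ax.
  by rewrite ltr_pM2r ?subr_gt0// mono// ltW.
have [c /andP[xc ca] E] := powR_increment x0 xa.
rewrite -[x - a]opprB -[x `^ p - _]opprB E mulrN ltrN2 ltr_pM2r ?subr_gt0// mono//.
by rewrite ltW// (lt_trans x0).
Qed.

(** The graph of [f] is invariant under [(x, y) |-> (k * x, k `^ p * y)], a linear
    map that sends tangents to tangents. *)
Lemma crossing_powRZ (k a b : R) : 0 < k -> 0 <= a -> a < b ->
  crossing f f' (k * a) (k * b) = k * crossing f f' a b.
Proof.
move=> k0 a0 ab; have b0 := le_lt_trans a0 ab.
have s : p * a `^ (p - 1) < p * b `^ (p - 1).
  apply: (slope_lt powR_above_tangents) => //; by rewrite nnegrE// ltW.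
have [k0' b0'] := (ltW k0, ltW b0).
rewrite /crossing !powRM//.
have -> : k `^ p = k * k `^ (p - 1) by rewrite mulr_powRB1// ltW.
have K0 : k `^ (p - 1) != 0 by rewrite gt_eqF// powR_gt0.
have s0 : a `^ (p - 1) - b `^ (p - 1) != 0.
  by rewrite subr_eq0 lt_eqF//; rewrite ltr_pM2l in s.
move: (k `^ (p - 1)) (a `^ (p - 1)) (b `^ (p - 1)) K0 s0 => K A B K0 s0.
field; rewrite -mulrBr -!mulrBr !mulf_neq0// ?gt_eqF//.
Qed.

End PowerFunction.

(** * Uniqueness of critical node sequences *)

Section Criticality.
Variables (R : realType) (p : R) (n : nat).
Hypothesis p1 : 1 < p.
Local Notation cr := (crossing (fun x : R => x `^ p) (fun x => p * x `^ (p - 1))).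

(** The first-order condition: every inner node is the midpoint of the two
    crossings next to it. *)
Definition critical (k : nat -> R) : Prop :=
  [/\ 0 <= k 0%N, forall i j, (i < j <= n)%N -> k i < k j &
      forall i, (0 < i < n)%N -> k i = (cr (k i.-1) (k i) + cr (k i) (k i.+1)) / 2].

(** Let [c] be the largest ratio [k' i / k i], attained at [m].  If [c > 1] then [m] is
    an inner index and [k' <= c * k] with equality at [m].  Equality at an inner index
    [j] forces equality at [j.+1]: the midpoint equation at [j] holds for both [k'] and
    [c * k], and its right-hand side is strictly increasing in the right
    neighbour.  Equality at [n] gives [c = 1]. *)
Lemma critical_le (k k' : nat -> R) : (0 < n)%N ->
    critical k -> critical k' -> k' 0%N = k 0%N -> k' n = k n ->
  forall i, (i <= n)%N -> k' i <= k i.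
Proof.
move=> n0 [k0 k_incr k_mid] [k'0 k'_incr k'_mid] k'k0 k'kn.
have k_gt0 i : (0 < i <= n)%N -> 0 < k i.
  by move=> i0n; apply: le_lt_trans (k_incr 0%N i i0n).
have k_ge0 i : (i <= n)%N -> 0 <= k i.
  by case: i => // i i_n; rewrite ltW// k_gt0.
have k'_ge0 i : (i <= n)%N -> 0 <= k' i.
  by case: i => // i i_n; apply: (le_trans k'0); rewrite ltW// k'_incr.
(* If [k 0] is [0] the ratio at [0] is [0] as well, and it does not affect the
   maximum because the ratio at [n] is [1]. *)
pose r (i : 'I_n.+1) := k' i / k i.
case: (@Order.TotalTheory.arg_maxP _ _ 'I_n.+1 ord_max xpredT r isT) => m _ rm.
pose c := r m.
have c1 : 1 <= c.
  by have := rm ord_max isT; rewrite /r /= k'kn divff ?gt_eqF// k_gt0// n0 leqnn.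
have c0 : 0 < c by exact: lt_le_trans c1.
have k'_le i : (i <= n)%N -> k' i <= c * k i.
  case: i => [_|i i_n]; first by rewrite k'k0 ler_peMl.
  have := rm (Ordinal (i_n : (i.+1 < n.+1)%N)) isT.
  by rewrite /r /= ler_pdivrMr// k_gt0.
suff c_eq1 : c = 1 by move=> i /k'_le; rewrite c_eq1 mul1r.
apply/eqP; rewrite eq_le c1 andbT leNgt; apply/negP => c_gt1.
have m0 : (0 < m)%N.
  rewrite lt0n; apply/eqP => m0; move: c_gt1; rewrite /c /r m0 k'k0.
  by have [->|kn0] := eqVneq (k 0%N) 0; rewrite ?mul0r ?divff// ?ltxx// ltr10.
have touch i : (m <= i <= n)%N -> k' i = c * k i.
  move=> /andP[mi i_n]; move: i_n; rewrite -(subnKC mi).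
  elim: (i - m)%N => [|d IH] mdn.
    by rewrite addn0 /c /r divfK// gt_eqF// k_gt0// m0 -ltnS ltn_ord.
  move: mdn; rewrite addnS => mdn; have {}IH := IH (ltnW mdn).
  set j := (m + d)%N in IH mdn *.
  have j0 : (0 < j)%N by rewrite /j addn_gt0 m0.
  have jj : (j.-1 < j <= n)%N by rewrite prednK// leqnn ltnW.
  have jS : (j < j.+1 <= n)%N by rewrite leqnn.
  have jn := ltnW mdn; have pjn : (j.-1 <= n)%N by exact: leq_trans (leq_pred _) jn.
  apply/eqP; rewrite eq_le k'_le//= leNgt; apply/negP => lt_next.
  have := k'_mid j; rewrite j0 mdn => /(_ isT).
  have := k_mid j; rewrite j0 mdn => /(_ isT) kE k'E.
  have hT := powR_above_tangents p1.
  have nn i' : (i' <= n)%N -> c * k i' \in Num.nneg.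
    by move=> i'n; rewrite nnegrE mulr_ge0 ?k_ge0// ltW.
  have nn' i' : (i' <= n)%N -> k' i' \in Num.nneg.
    by move=> i'n; rewrite nnegrE k'_ge0.
  have left_le : cr (k' j.-1) (k' j) <= c * cr (k j.-1) (k j).
    rewrite -(crossing_powRZ p1)// ?k_ge0 ?k_incr//.
    apply: (crossing_le hT); rewrite ?nn ?nn' ?k'_incr ?k'_le//.
    by rewrite ltr_pM2l// k_incr.
  have right_lt : cr (k' j) (k' j.+1) < c * cr (k j) (k j.+1).
    rewrite -(crossing_powRZ p1)// ?k_ge0 ?k_incr// -IH.
    by apply: (crossing_ltr hT); rewrite ?nn ?nn' ?k'_incr.
  have := ltr_leD right_lt left_le.
  have ckE : c * k j = c * (cr (k j.-1) (k j) + cr (k j) (k j.+1)) / 2.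
    by rewrite {1}kE mulrA.
  by move: ckE k'E IH; rewrite mulrDr; lra.
have := touch n; rewrite -ltnS ltn_ord leqnn k'kn => /(_ isT).
move/eqP; rewrite eq_sym -subr_eq0 -{2}[k n]mul1r -mulrBl mulf_eq0 subr_eq0.
by rewrite (gt_eqF c_gt1) gt_eqF// k_gt0// n0 leqnn.
Qed.

End Criticality.

(** * Strictly increasing node sequences *)

Section Knots.
Variables (R : realType) (l u : R) (n : nat) (xi : n.-1.-tuple R).
Hypothesis n0 : (0 < n)%N.
Local Notation k := (nth 0 (knots l u xi)).

Lemma size_knots : size (knots l u xi) = n.+1.
Proof. by rewrite /= size_rcons size_tuple prednK. Qed.

Lemma knots_last : k n = u.
Proof.
by have := nth_last 0 (knots l u xi); rewrite size_knots /= last_rcons.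
Qed.

Lemma knots_node i : (0 < i < n)%N -> k i \in val xi.
Proof.
case: i => // i /= i_n; have {}i_n : (i < n.-1)%N by rewrite -ltnS prednK.
by rewrite nth_rcons size_tuple i_n mem_nth// size_tuple.
Qed.

Lemma mem_knotsP x : x \in [:: l, u & xi] <-> exists2 i, (i <= n)%N & x = k i.
Proof.
have -> : (x \in [:: l, u & xi]) = (x \in knots l u xi).
  by rewrite !inE mem_rcons inE.
split=> [xk|[i i_n ->]]; last by rewrite mem_nth// size_knots.
exists (index x (knots l u xi)); last by rewrite nth_index.
by rewrite -ltnS -size_knots index_mem.
Qed.

Hypothesis srt : sorted <%R (knots l u xi).

Lemma knots_incr i j : (i < j <= n)%N -> k i < k j.
Proof.
move=> /andP[ij jn]; rewrite lt_sorted_ltn_nth// inE size_knots ltnS//.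
exact/ltnW/(leq_trans ij).
Qed.

Lemma knots_in : {subset [:: l, u & xi] <= `[l, u]}.
Proof.
move=> _ /mem_knotsP[i i_n ->]; rewrite in_itv/=; apply/andP; split.
  by case: i i_n => [|i] i_n; [exact: lexx|exact/ltW/(@knots_incr 0%N)].
move: i_n; rewrite leq_eqVlt => /predU1P[->|i_n]; first by rewrite knots_last.
by have := @knots_incr i n; rewrite knots_last i_n leqnn => /(_ isT)/ltW.
Qed.

Lemma knots_gap i : (0 < i < n)%N ->
  {in [:: l, u & xi], forall s, [|| s <= k i.-1, s == k i | k i.+1 <= s]}.
Proof.
move=> /andP[i0 i_n] _ /mem_knotsP[j jn ->].
have [ji|ij|->] := ltngtP j i; last by rewrite eqxx orbT.
  apply/or3P/Or31; move: ji; rewrite -{1}(prednK i0) ltnS leq_eqVlt.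
  move=> /predU1P[->//|ji]; rewrite ltW// knots_incr// ji/=.
  by rewrite (leq_trans (leq_pred _))// ltnW.
apply/or3P/Or33; move: ij; rewrite leq_eqVlt => /predU1P[->//|ij].
by rewrite ltW// knots_incr// ij.
Qed.

End Knots.

Section SortedKnots.
Variables (R : realType) (l u : R).

Lemma sorted_knots_sort n (S : n.-1.-tuple R) : uniq [:: l, u & S] ->
  {subset S <= `[l, u]} -> l < u -> sorted <%R (knots l u (sort_tuple <=%R S)).
Proof.
move=> uS Slu lu; rewrite lt_sorted_uniq_le; apply/andP; split.
  rewrite (perm_uniq (_ : perm_eq _ [:: l, u & S]))// perm_cons perm_rcons.
  by rewrite perm_cons perm_sort.
have inlu x : x \in sort <=%R S -> l <= x <= u.
  by rewrite mem_sort => /Slu; rewrite in_itv.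
rewrite /knots/= rcons_path path_min_sorted.
  rewrite sort_le_sorted/=.
  have := mem_last l (sort <=%R S); rewrite inE => /predU1P[->|/inlu/andP[]//].
  exact: ltW.
by apply/allP => x /inlu/andP[].
Qed.
End SortedKnots.

(** Halving the interval at each entry of [s] keeps a subinterval free of it. *)
Lemma exists_fresh (R : realType) (s : seq R) (a b : R) : a < b ->
  exists2 x, a < x < b & x \notin s.
Proof.
elim: s a b => [|y s IH] a b ab.
  by exists ((a + b) / 2) => //; apply/andP; split; lra.
have [ym|my] := leP y ((a + b) / 2).
  have [|x /andP[ax xb] xs] := IH ((a + b) / 2) b; first by lra.
  exists x; first by apply/andP; split => //; lra.
  by rewrite inE negb_or xs andbT gt_eqF// (le_lt_trans ym).
have [|x /andP[ax xb] xs] := IH a ((a + b) / 2); first by lra.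
exists x; first by apply/andP; split => //; lra.
by rewrite inE negb_or xs andbT lt_eqF// (lt_trans xb).
Qed.

(** * Optimal node sequences for power functions *)

Section TangentsOfPower.
Variables (R : realType) (p l u : R) (n : nat).
Hypothesis p1 : 1 < p.
Hypothesis l0 : 0 <= l.
Hypothesis lu : l < u.
Hypothesis n0 : (0 < n)%N.
Local Notation mu := (@lebesgue_measure R).
Local Notation f := (fun x : R => x `^ p).
Local Notation f' := (fun x : R => p * x `^ (p - 1)).
Local Notation env := (envelope f f' l u).
Local Notation G := (envelope_integral f f' l u).
Local Notation cr := (crossing f f').
Implicit Types (S xi eta : n.-1.-tuple R).

Let hT : above_tangents f f' Num.nneg := powR_above_tangents p1.

Let luD : {subset `[l, u] <= (Num.nneg : {pred R})}.
Proof. by move=> x; rewrite in_itv/= nnegrE => /andP[lx _]; exact: le_trans lx. Qed.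

Let lD : l \in Num.nneg. Proof. by rewrite nnegrE. Qed.
Let uD : u \in Num.nneg. Proof. by rewrite nnegrE (le_trans l0) ?ltW. Qed.

Lemma powR_envelope_ge0 (S : seq R) : {in `[l, u], forall x, 0 <= env S x}.
Proof.
move=> x; rewrite in_itv/= => /andP[lx _].
apply: (@le_trans _ _ (tline f f' l x)).
  rewrite /tline addr_ge0 ?powR_ge0// !mulr_ge0 ?powR_ge0 ?subr_ge0//.
  by rewrite ltW ?(lt_trans ltr01).
by rewrite tline_le_envelope ?inE ?eqxx.
Qed.

(** A tangent is below [f], hence below the secant, at both ends of [[l, u]], and
    the difference is affine. *)
Lemma powR_envelope_le_secant (S : seq R) : {subset [:: l, u & S] <= `[l, u]} ->
  {in `[l, u], forall x,
    env S x <= f l - secant_slope f l u * l + secant_slope f l u * x}.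
Proof.
move=> Slu x; rewrite in_itv/= => /andP[lx xu]; apply: envelope_le => s /Slu/luD sD.
have ul : 0 < u - l by rewrite subr_gt0.
rewrite -subr_ge0 -(pmulr_rge0 _ ul).
have -> : (u - l) * (f l - secant_slope f l u * l + secant_slope f l u * x
    - tline f f' s x)
    = (u - x) * (f l - tline f f' s l) + (x - l) * (f u - tline f f' s u).
  by rewrite /secant_slope /tline; field; rewrite gt_eqF.
by rewrite addr_ge0// mulr_ge0 ?subr_ge0// (le_tline hT).
Qed.

Lemma vol3_U_star xi : sorted <%R (knots l u xi) ->
  vol3 (U_star p l u xi) =
    ((\int[mu]_(x in `[l, u])
        (f l - secant_slope f l u * l + secant_slope f l u * x) - G xi) / 3)%:E.
Proof.
move=> srt; rewrite /U_star.
rewrite (@vol3_perspective_relaxation R f f' l u xi)//.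
- rewrite RintegralB//; apply: continuous_itv_integrable.
    exact: continuous_affine.
  exact: continuous_envelope.
- apply: (pl_under_envelope hT luD n0) => //.
  + by move=> i j; exact: knots_incr.
  + exact: knots_last.
  + exact: mem_knotsP.
- exact: powR_envelope_ge0.
- exact/powR_envelope_le_secant/knots_in.
Qed.

(** The volume is a decreasing affine function of the integral of the envelope. *)
Lemma vol3_U_star_le xi eta :
    sorted <%R (knots l u xi) -> sorted <%R (knots l u eta) ->
  (vol3 (U_star p l u xi) <= vol3 (U_star p l u eta))%E <-> G eta <= G xi.
Proof.
have le_of_eq (a b : \bar R) (c x y : R) :
    a = ((c - x) / 3)%:E -> b = ((c - y) / 3)%:E -> (a <= b)%E <-> y <= x.
  by move=> -> ->; rewrite lee_fin ler_pM2r ?invr_gt0// lerD2l lerN2.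
by move=> sx se; exact: le_of_eq (vol3_U_star sx) (vol3_U_star se).
Qed.

(** Starts from a maximizer [S] over the cube.  If the entries of [S] that differ
    from [l] and [u], without repetitions, are fewer than [n.-1], there is room
    for a new tangency point, which contradicts maximality. *)
Lemma exists_best_nodes : exists2 xi : n.-1.-tuple R,
  sorted <%R (knots l u xi) &
  forall S, {subset S <= `[l, u]} -> G S <= G xi.
Proof.
have [S Slu Smax] : exists2 S : n.-1.-tuple R, {subset S <= `[l, u]} &
    forall S' : n.-1.-tuple R, {subset S' <= `[l, u]} -> G S' <= G S.
  apply: envelope_integral_max => //.
    by apply: continuous_within_powR => //; exact: lt_trans p1.
  have cq : {within `[l, u], continuous (fun x : R => x `^ (p - 1))}.
    by apply: continuous_within_powR => //; rewrite subr_gt0.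
  move=> x; apply: (cvgM _ (cq x)); exact: cvg_cst.
have Slu' : {subset [:: l, u & S] <= `[l, u]}.
  move=> x; rewrite in_cons in_cons => /or3P[/eqP->|/eqP->|/Slu//].
    by rewrite in_itv/= lexx ltW.
  by rewrite in_itv/= lexx ltW.
have uS : uniq [:: l, u & S].
  pose inner := [seq s <- S | s \notin [:: l; u]].
  pose core := undup inner.
  have [core_small|core_full] := ltnP (size core) n.-1.
    have [x0 x0lu x0S] := exists_fresh S lu.
    (* Repeating the fresh point [x0] pads the tuple to the required length. *)
    have sz : size (x0 :: core ++ nseq (n.-1 - (size core).+1) x0) == n.-1.
      by rewrite /= size_cat size_nseq -addSn subnKC.
    pose S' := Tuple sz.
    have memS' x : x \in S' = (x == x0) || (x \in core).
      rewrite inE mem_cat mem_nseq.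
      by case: (x == x0) => //=; rewrite andbF orbF.
    have S'lu : {subset S' <= `[l, u]}.
      move=> x; rewrite memS' => /predU1P[->|].
        by case/andP: x0lu => ? ?; rewrite in_itv/= !ltW.
      by rewrite mem_undup mem_filter => /andP[_ /Slu].
    suff : G S < G S' by rewrite ltNge Smax.
    apply: (envelope_integral_insert hT luD) Slu' _ _ x0S _.
    - move=> x; rewrite in_cons in_cons => xS; rewrite in_cons in_cons memS'.
      rewrite mem_undup mem_filter !inE.
      by case: (x == l) xS => //=; case: (x == u) => //= ->; rewrite orbT.
    - by rewrite in_itv.
    - by rewrite memS' eqxx.
  have inner_le : (size inner <= n.-1)%N.
    by rewrite size_filter (leq_trans (count_size _ _))// size_tuple.
  have ui : uniq inner.
    rewrite -[uniq _]negbK -ltn_size_undup -leqNgt.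
    exact: leq_trans inner_le core_full.
  have allS : all (fun s => s \notin [:: l; u]) S.
    rewrite all_count -size_filter -/inner size_tuple eqn_leq inner_le/=.
    by apply: (leq_trans core_full); exact: size_undup.
  have innerE : inner = S by apply/all_filterP.
  rewrite /= inE negb_or (lt_eqF lu) -innerE ui andbT /=.
  apply/andP; split; apply/negP; rewrite innerE => /(allP allS);
    by rewrite !inE eqxx ?orbT.
exists (sort_tuple <=%R S); first exact: sorted_knots_sort.
move=> S' /Smax/le_trans; apply.
by apply: envelope_integral_sub => x; rewrite !inE mem_sort.
Qed.

(** Recentring a node would improve the envelope; the recentred tuple need not be
    compared in order, since [xi] is optimal among all tuples in [[l, u]]. *)
Lemma best_nodes_critical xi : sorted <%R (knots l u xi) ->
    (forall S, {subset S <= `[l, u]} -> G S <= G xi) ->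
  critical p n (nth 0 (knots l u xi)).
Proof.
move=> srt best; set k := nth 0 _.
split=> [//|i j|i i0n]; first exact: knots_incr.
apply/eqP; apply: contraT => bz; set z := _ / 2 in bz *.
have [i0 i_n] := andP i0n.
have pi : (i.-1 < i)%N by rewrite prednK.
have pin : (i.-1 <= n)%N by rewrite (leq_trans (leq_pred _))// ltnW.
have ab : k i.-1 < k i by apply: knots_incr => //; rewrite pi ltnW.
have bc : k i < k i.+1 by apply: knots_incr => //; rewrite ltnSn.
have klu j : (j <= n)%N -> k j \in [:: l, u & xi].
  by move=> jn; apply/mem_knotsP => //; exists j.
have kD j : (j <= n)%N -> k j \in Num.nneg.
  by move=> jn; apply/luD/(knots_in n0 srt)/klu.
have zlu : z \in `[l, u].
  have := knots_in n0 srt (klu _ pin); have := knots_in n0 srt (klu _ i_n).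
  rewrite !in_itv/= => /andP[_ cu] /andP[la _].
  have := crossing_gt hT (kD _ pin) (kD _ (ltnW i_n)) ab.
  have := crossing_lt hT (kD _ pin) (kD _ (ltnW i_n)) ab.
  have := crossing_gt hT (kD _ (ltnW i_n)) (kD _ i_n) bc.
  have := crossing_lt hT (kD _ (ltnW i_n)) (kD _ i_n) bc.
  by rewrite /z => *; apply/andP; split; lra.
(* The tuple in which the node [k i] has moved to [z]. *)
pose S : n.-1.-tuple R := map_tuple (fun s => if s == k i then z else s) xi.
have Slu : {subset S <= `[l, u]}.
  move=> _ /mapP[s sxi ->]; case: ifP => // _.
  by apply: (knots_in n0 srt); rewrite !inE sxi !orbT.
have := best S Slu; rewrite leNgt => /negP[].
apply: (@envelope_integral_recentre _ _ _ _ _ _ hT luD xi S (k i.-1) (k i) (k i.+1)) => //.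
- exact: knots_in.
- exact: klu.
- exact: knots_node.
- exact: klu.
- exact: knots_gap.
- move=> s; rewrite !inE => /or3P[->//|->|sxi sk]; first by rewrite orbT.
  by apply/or3P/Or33/mapP; exists s; rewrite // (negbTE sk).
- by apply/mapP; exists (k i); rewrite ?eqxx// knots_node.
Qed.

End TangentsOfPower.

Theorem corollary3p6 (R : realType) (p l u : R) (n : nat)
    (hp : 1 < p <= 2) (hl : 0 <= l) (hlu : l < u) (hn : (2 <= n)%N) :
  exists! xi : n.-1.-tuple R,
    sorted <%R (knots l u xi) /\
    forall eta : n.-1.-tuple R, sorted <%R (knots l u eta) ->
      (vol3 (U_star p l u xi) <= vol3 (U_star p l u eta))%E.
Proof.
have p1 : 1 < p by case/andP: hp.
have n0 : (0 < n)%N by exact: leq_trans hn.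
have [xi srt best] := exists_best_nodes n p1 hl hlu.
exists xi; split.
  split; first exact: srt.
  move=> eta se; apply/(vol3_U_star_le p1 hl hlu n0 srt se)/best => x xe.
  by apply: (knots_in n0 se); rewrite !inE xe !orbT.
move=> eta [se eta_min].
pose f (x : R) := x `^ p; pose f' (x : R) := p * x `^ (p - 1).
have best_eta (S : n.-1.-tuple R) : {subset S <= `[l, u]} ->
    envelope_integral f f' l u S <= envelope_integral f f' l u eta.
  move=> /best/le_trans; apply.
  exact/(vol3_U_star_le p1 hl hlu n0 se srt)/eta_min.
have cx := best_nodes_critical p1 hl n0 srt best.
have ce := best_nodes_critical p1 hl n0 se best_eta.
have knots_eq i : (i <= n)%N ->
    nth 0 (knots l u xi) i = nth 0 (knots l u eta) i.
  move=> i_n; apply/le_anti/andP.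
  split; apply: (@critical_le R p n p1 _ _ n0) i_n => //;
    by rewrite !knots_last.
have : knots l u xi = knots l u eta.
  apply: (@eq_from_nth _ 0); first by rewrite !size_knots.
  by move=> i; rewrite size_knots// ltnS => /knots_eq.
by move=> [/rcons_inj[/val_inj]].
Qed.
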